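(* There exist sequences $(\epsilon_m)_{m\in\mathbb N}$ and $(r_m)_{m\in\mathbb N}$ such that $(\epsilon_m)$ is a decreasing sequence of positive reals tending to $0$ with $\epsilon_1<1$, and $(r_m)$ is a strictly increasing sequence with $r_1\ge4$, $r_m^{\epsilon_m}\in\mathbb N$ for all $m\in\mathbb N$, \[ r_{k+1}^{\epsilon_{k+1}}\ge r_k^{k+1}\ \text{ for all } k\in\mathbb N,\qquad\text{and}\qquad \epsilon_k(\log r_k)^{1/k}\to\infty\ \text{ as } k\to\infty. \] For any such sequences, the function \[ f(z)=\prod_{m=1}^\infty\left(1-\frac{z}{r_m}\right)^{r_m^{\epsilon_m}} \] is a transcendental entire function of order zero for which there do not exist $0<\delta\le1$, $L>1$ and $C>0$ such that, for all sufficiently large $r$, there exists $t\in(r,r^L)$ with \[ \frac{\log m(t)}{\log M(r)}\ge L\left(1-\frac{C}{(\log r)^\delta}\right). \]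
   Context: For an entire function $f$ and $r>0$, $M(r)=\max_{|z|=r}|f(z)|$ and $m(r)=\min_{|z|=r}|f(z)|$. The order of $f$ is $\limsup_{r\to\infty}\frac{\log\log M(r)}{\log r}$. $\mathbb N=\{1,2,\dots\}$; $\log 0=-\infty$. *)

(* Defs.v *)
From mathcomp Require Import all_boot all_order all_algebra.
From mathcomp Require Import complex.
From mathcomp Require Import all_classical all_reals all_analysis.

Set Implicit Arguments.
Unset Strict Implicit.
Unset Printing Implicit Defensive.

Import Order.TTheory GRing.Theory Num.Theory.
Import numFieldNormedType.Exports.

Local Open Scope classical_set_scope.
Local Open Scope ring_scope.
Local Open Scope complex_scope.

(** The sequences are indexed by m = 1, 2, ...; the value at index 0 of a
    function on [nat] is never constrained nor used. *)

Definition admissible (R : realType) (eps r : R^nat) : Prop :=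
  [/\ [/\ forall m, (0 < m)%N -> 0 < eps m,
          forall m n, (0 < m)%N -> (m <= n)%N -> eps n <= eps m,
          eps @ \oo --> 0
        & eps 1%N < 1],
      [/\ forall m n, (0 < m)%N -> (m < n)%N -> r m < r n
        & 4 <= r 1%N],
      forall m, (0 < m)%N -> exists2 n : nat, (0 < n)%N & r m `^ eps m = n%:R,
      forall k, (0 < k)%N -> r k.+1 `^ eps k.+1 >= r k ^+ k.+1
    & eps k * ln (r k) `^ k%:R^-1 @[k --> \oo] --> +oo].

(** The exponent [r m `^ eps m] is a natural number for admissible sequences,
    so that the truncation does not change its value. *)
Definition partial_product (R : realType) (eps r : R^nat) (N : nat) (z : R[i])
    : R[i]^o :=
  \prod_(1 <= m < N.+1) (1 - z / (r m)%:C) ^+ Num.truncn (r m `^ eps m).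

Definition infinite_product (R : realType) (eps r : R^nat) (z : R[i]) : R[i] :=
  lim (partial_product eps r N z @[N --> \oo]).

(** [derivable g z 1] over the field [R[i]] is complex differentiability. *)
Definition entire (R : realType) (f : R[i] -> R[i]) : Prop :=
  forall z : R[i], derivable (f : R[i]^o -> R[i]^o) z 1.

Definition transcendental_entire (R : realType) (f : R[i] -> R[i]) : Prop :=
  entire f /\ ~ exists p : {poly R[i]}, forall z, f z = p.[z].

Definition circle_values (R : realType) (f : R[i] -> R[i]) (r : R) : set R :=
  [set Normc.normc (f z) | z in [set z : R[i] | Normc.normc z = r]].

(** Maximum and minimum modulus; the default value 0 of [xget] is only used
    when the maximum (resp. minimum) does not exist, which cannot occur for an
    entire [f] and [0 < r]. *)
Definition max_modulus (R : realType) (f : R[i] -> R[i]) (r : R) : R :=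
  xget 0 (circle_values f r `&` ubound (circle_values f r)).

Definition min_modulus (R : realType) (f : R[i] -> R[i]) (r : R) : R :=
  xget 0 (circle_values f r `&` lbound (circle_values f r)).

(** [lne] is the extended logarithm, with value -oo at 0. *)
Definition growth_order (R : realType) (f : R[i] -> R[i]) : \bar R :=
  limf_esup (fun r : R => lne (lne (max_modulus f r)%:E) / lne r%:E)%E +oo.

(* Main.v *)
Require Import Defs.
From mathcomp Require Import all_boot all_order all_algebra.
From mathcomp Require Import complex.
From mathcomp Require Import all_classical all_reals all_analysis.
From mathcomp Require Import ring lra.

Import Order.TTheory GRing.Theory Num.Theory.
Import numFieldNormedType.Exports.

Local Open Scope classical_set_scope.
Local Open Scope ring_scope.

(** Write n_m = r_m^eps_m for the multiplicity of the zero r_m.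

    Everything that concerns |f| from above is read off the real majorant
    F(x) = \prod_m (1 + x / r_m)^n_m: one has |f(z)| <= F(|z|), with equality
    at z = -|z|, so F is the maximum modulus of f ([max_modulusE]).  Since
    eps_m tends to 0 and r_m >= 2^m, the sum of n_m r_m^(-a) is finite for every
    a > 0, and 1 + x <= exp (c x^a) turns this into F(x) <= exp (B x^a) for
    every a in (0, 1] ([majorant_le_expR]).  This gives at once the convergence
    of the product and the order zero of f.

    Differentiability of f is proved by hand.  If a factor q has derivative d
    at z, then d, the increments of q near z and their first-order remainders
    are controlled by the increment of the majorant of q between |z| and
    |z| + 1; such bounds are stable under products ([jet_boundM]), so the second-order
    remainder of the partial products is bounded uniformly, and their
    derivatives at z have increments dominated by those of a convergent
    monotone sequence.  Both facts pass to the limit ([product_derivable]).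
    As f(0) = 1 and f vanishes at infinitely many points, f is not a polynomial.

    For the negative result, put k large, x = log r_k, e = eps_k, X =
    log r_(k-1), N = n_1 + ... + n_(k-1) and take rho = r_k^(1/L), so that
    (rho, rho^L) ends at the zero r_k.  The zeros before r_k give
    log M(rho) >= N (x/L - X), whereas
    log m(t) <= N log t - n_k t / r_k ([infinite_product_near_zero]).  If
    log t <= (1 - e/2) x, the ratio is at most about L (1 - e/2) / (1 - LX/x);
    if log t is larger, then n_k t / r_k >= exp (e x / 2) >= N x and
    log m(t) is negative.  The sparseness of the zeros gives X <= e x / k, and
    e x^(1/k) -> oo makes e much larger than x^(-delta); so in both cases the
    ratio is less than L (1 - C / (log rho)^delta)
    ([jump_inequality], [no_min_modulus_bound]). *)

Local Notation cmod := (@Normc.normc _).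

(** * Modulus and convergence of complex sequences *)

Section Modulus.
Local Set Implicit Arguments.
Local Unset Strict Implicit.
Variable R : realType.
Implicit Types (x y : R) (z w : R[i]).

Lemma normr_le_cmod (z : R[i]^o) x : (`|z| <= x%:C%C) = (cmod z <= x).
Proof. exact: lecR. Qed.

Lemma cmod_ge0 z : 0 <= cmod z.
Proof. by case: z => a b; exact: sqrtr_ge0. Qed.

Lemma cmodD z w : cmod (z + w) <= cmod z + cmod w.
Proof. exact: le_normcD. Qed.

Lemma cmodN z : cmod (- z) = cmod z.
Proof. exact: normcN. Qed.

Lemma cmodR x : cmod x%:C%C = `|x|.
Proof. by rewrite /= expr0n /= addr0 sqrtr_sqr. Qed.

Lemma cmodB_ge z w : `|cmod z - cmod w| <= cmod (z - w).
Proof.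
have H z' w' : cmod z' - cmod w' <= cmod (z' - w').
  by rewrite lerBlDr (le_trans _ (cmodD _ _))// subrK.
by rewrite ler_norml H andbT lerNl opprB (le_trans (H _ _))// -cmodN opprB.
Qed.

Lemma cmod_Re_le z : `|complex.Re z| <= cmod z.
Proof.
by case: z => a b /=; rewrite -sqrtr_sqr ler_wsqrtr// lerDl sqr_ge0.
Qed.

Lemma cmod_Im_le z : `|complex.Im z| <= cmod z.
Proof.
by case: z => a b /=; rewrite -sqrtr_sqr ler_wsqrtr// lerDr sqr_ge0.
Qed.

Lemma cmod_le_ReIm z : cmod z <= `|complex.Re z| + `|complex.Im z|.
Proof.
case: z => a b /=; rewrite -[leRHS]ger0_norm ?addr_ge0// -[leRHS]sqrtr_sqr.
rewrite ler_wsqrtr// sqrrD !real_normK ?num_real// -addrA lerD2l lerDr.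
by rewrite mulrn_wge0// mulr_ge0.
Qed.

Lemma cvg_cmodP (T : Type) (F : set_system T) {FF : Filter F}
    (u : T -> R[i]^o) (l : R[i]^o) :
  u t @[t --> F] --> l <-> cmod (u t - l) @[t --> F] --> (0 : R).
Proof.
split => [/cvgrPdist_le ul|ul].
  apply/cvgrPdist_le => e e0.
  have e0' : (0 : R[i]) < e%:C%C by rewrite ltcR.
  apply: filterS (ul _ e0') => t.
  rewrite -(opprB (u t)) normrN normr_le_cmod => h.
  by rewrite sub0r normrN ger0_norm ?cmod_ge0.
apply/cvgrPdist_le => -[e e'] e0.
have [e'0 e0'] : e' = 0 /\ 0 < e.
  by move: e0; rewrite ltcE /= => /andP[/eqP].
rewrite e'0.
move/cvgrPdist_le: ul => /(_ _ e0'); apply: filterS => t.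
rewrite sub0r normrN ger0_norm ?cmod_ge0// => h.
by rewrite -(opprB (u t)) normrN (normr_le_cmod _ e).
Qed.

Lemma cvg_cmod (T : Type) (F : set_system T) {FF : Filter F}
    (u : T -> R[i]^o) (l : R[i]^o) :
  u t @[t --> F] --> l -> cmod (u t) @[t --> F] --> (cmod l : R).
Proof.
move=> /cvg_cmodP /cvgrPdist_le ul; apply/cvgrPdist_le => e e0.
apply: filterS (ul _ e0) => t; rewrite sub0r normrN ger0_norm ?cmod_ge0//.
by apply: le_trans; rewrite distrC cmodB_ge.
Qed.

Lemma majorized_increment_le (u : nat -> R[i]) (g : R^nat) :
  (forall n, cmod (u n.+1 - u n) <= g n.+1 - g n) ->
  forall m n, (m <= n)%N -> cmod (u n - u m) <= g n - g m.
Proof.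
move=> ug m n /subnKC <-; elim: (n - m)%N => [|k IHk].
  by rewrite addn0 !subrr Normc.normc0.
rewrite addnS -(subrKA (u (m + k)%N)) -(subrKA (g (m + k)%N)).
exact: le_trans (cmodD _ _) (lerD (ug _) IHk).
Qed.

(** The hypothesis makes [v + g] nondecreasing and bounded, so that it converges,
    and [v] is the difference of two convergent sequences. *)
Lemma real_majorized_cvg (v g : R^nat) :
  (forall m n, (m <= n)%N -> `|v n - v m| <= g n - g m) -> cvgn g -> cvgn v.
Proof.
move=> vg gcvg.
have bg : exists B, forall n, g n <= B.
  have /cvg_seq_bounded[B [_ /(_ (B + 1))]] := gcvg.
  rewrite ltrDl ltr01 => /(_ isT) H; exists (B + 1) => n.
  exact: le_trans (ler_norm _) (H n I).
have [B gB] := bg.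
have c : cvgn (v + g).
  apply: nondecreasing_is_cvgn.
    move=> m n mn; have := vg _ _ mn; rewrite ler_norml => /andP[H _].
    by rewrite /= fctE; lra.
  exists (`|v 0%N| + `|g 0%N| + B + B) => _ [n _ <-]; rewrite fctE.
  have := vg _ _ (leq0n n); rewrite ler_norml => /andP[_ H].
  have := ler_norm (v 0%N); have := ler_norm (- g 0%N); rewrite normrN.
  by have := gB n; have := gB 0%N; lra.
have -> : v = (v + g) - g by rewrite addrK.
exact: is_cvgB.
Qed.

(** The real and imaginary parts inherit the bounds on the increments, so that
    each of them converges. *)
Lemma majorized_cvg (u : nat -> R[i]^o) (g : R^nat) :
  (forall n, cmod (u n.+1 - u n) <= g n.+1 - g n) -> cvgn g ->
  cvg (u n @[n --> \oo]).
Proof.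
move=> ug gcvg.
have h := majorized_increment_le ug.
have cR : cvgn (fun n => complex.Re (u n)).
  apply: (@real_majorized_cvg _ g) => // m n mn; rewrite -raddfB.
  exact: le_trans (cmod_Re_le _) (h _ _ mn).
have cI : cvgn (fun n => complex.Im (u n)).
  apply: (@real_majorized_cvg _ g) => // m n mn; rewrite -raddfB.
  exact: le_trans (cmod_Im_le _) (h _ _ mn).
set a := limn (fun n => complex.Re (u n)); set b := limn (fun n => complex.Im (u n)).
apply/cvg_ex; exists (a +i* b)%C; apply/cvg_cmodP.
apply: (@squeeze_cvgr _ _ _ _ (cst 0)
   (fun n => `|complex.Re (u n) - a| + `|complex.Im (u n) - b|)).
- near=> n; rewrite cmod_ge0 /=; apply: le_trans (cmod_le_ReIm _) _.
  by case: (u n).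
- exact: cvg_cst.
- rewrite -[X in _ --> X](addr0 0); apply: cvgD.
    by rewrite -(@normr0 _ R) -(subrr a); apply: cvg_norm; apply: cvgB => //; exact: cvg_cst.
  by rewrite -(@normr0 _ R) -(subrr b); apply: cvg_norm; apply: cvgB => //; exact: cvg_cst.
Unshelve. all: by end_near. Qed.

End Modulus.

(** * First-order expansions of products with uniform remainders *)

Section Jets.
Variable R : realType.
Local Set Implicit Arguments.
Local Unset Strict Implicit.
Implicit Types (a b : R) (z w h d : R[i]) (q : R[i] -> R[i]).

(** [a] and [b] stand for the values at |z| and |z| + 1 of a power series with
    nonnegative coefficients that dominates that of [q], and [d] for the
    derivative of [q] at [z].  With a single bound in place of the pair (a, b)
    the notion would not be stable under products. *)
Definition jet_bound z q d a b : Prop :=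
  [/\ 1 <= a <= b, cmod (q z - 1) <= a - 1, cmod d <= b - a
    & forall h, cmod h <= 1 ->
      cmod (q (z + h) - q z) <= cmod h * (b - a) /\
      cmod (q (z + h) - q z - h * d) <= cmod h ^+ 2 * (b - a)].

Lemma jet_bound_le z q d a b : jet_bound z q d a b -> cmod (q z) <= a.
Proof.
case=> _ q1 _ _; rewrite -[q z](subrK 1); apply: le_trans (cmodD _ _) _.
by rewrite Normc.normc1; lra.
Qed.

Lemma jet_bound1 z : jet_bound z (fun=> 1) 0 1 1.
Proof.
split; rewrite ?lexx ?subrr ?Normc.normc0 // => h _.
by rewrite !mulr0 subr0 Normc.normc0.
Qed.

Lemma jet_bound_linear z w :
  jet_bound z (fun y => 1 + y * w) w
    (1 + cmod z * cmod w) (1 + (cmod z + 1) * cmod w).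
Proof.
have w0 := cmod_ge0 w; have z0 := cmod_ge0 z.
have zw0 : 0 <= cmod z * cmod w by exact: mulr_ge0.
have wE : 1 + (cmod z + 1) * cmod w - (1 + cmod z * cmod w) = cmod w by ring.
split.
- by rewrite lerDl zw0 -subr_ge0 wE w0.
- by rewrite addrC addKr Normc.normcM; lra.
- by rewrite wE.
- move=> h _.
  have E : 1 + (z + h) * w - (1 + z * w) = h * w by ring.
  by rewrite wE E subrr Normc.normc0 Normc.normcM lexx mulr_ge0 ?exprn_ge0 ?cmod_ge0.
Qed.

(** With Dq = q(z + h) - q(z), the increment of a product is
    q1 Dq2 + Dq1 q2 + Dq1 Dq2, and
    a1 (b2 - a2) + (b1 - a1) a2 + (b1 - a1) (b2 - a2) = b1 b2 - a1 a2. *)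
Lemma jet_boundM z q1 d1 a1 b1 q2 d2 a2 b2 :
  jet_bound z q1 d1 a1 b1 -> jet_bound z q2 d2 a2 b2 ->
  jet_bound z (fun y => q1 y * q2 y) (d1 * q2 z + q1 z * d2)
    (a1 * a2) (b1 * b2).
Proof.
move=> J1 J2; have q1a := jet_bound_le J1; have q2a := jet_bound_le J2.
case: J1 => /andP[a1_1 ab1] Q1 D1 H1; case: J2 => /andP[a2_1 ab2] Q2 D2 H2.
have a1_0 : 0 <= a1 by lra.
have a2_0 : 0 <= a2 by lra.
split.
- by rewrite -[leLHS]mulr1 ler_pM//= ler_pM.
- have -> : q1 z * q2 z - 1 = q1 z * (q2 z - 1) + (q1 z - 1) by ring.
  apply: le_trans (cmodD _ _) _; rewrite Normc.normcM.
  have := ler_pM (cmod_ge0 _) (cmod_ge0 _) q1a Q2; lra.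
- apply: le_trans (cmodD _ _) _; rewrite !Normc.normcM.
  have := ler_pM (cmod_ge0 _) (cmod_ge0 _) q1a D2.
  have := ler_pM (cmod_ge0 _) (cmod_ge0 _) D1 q2a.
  have : 0 <= (b1 - a1) * (b2 - a2) by rewrite mulr_ge0 ?subr_ge0.
  lra.
- move=> h h1; have [H11 H12] := H1 _ h1; have [H21 H22] := H2 _ h1.
  have h0 := cmod_ge0 h.
  have hh0 : 0 <= cmod h ^+ 2 by exact: exprn_ge0.
  have ba : 0 <= (b1 - a1) * (b2 - a2) by rewrite mulr_ge0 ?subr_ge0.
  have hh : cmod h ^+ 2 <= cmod h by rewrite expr2 -[leRHS]mulr1 ler_wpM2l.
  have X1 := ler_pM (cmod_ge0 _) (cmod_ge0 _) q1a H21.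
  have X2 := ler_pM (cmod_ge0 _) (cmod_ge0 _) H11 q2a.
  have X3 := ler_pM (cmod_ge0 _) (cmod_ge0 _) H11 H21.
  have X4 := ler_pM (cmod_ge0 _) (cmod_ge0 _) q1a H22.
  have X5 := ler_pM (cmod_ge0 _) (cmod_ge0 _) H12 q2a.
  have X6 : cmod h ^+ 2 * ((b1 - a1) * (b2 - a2)) <=
            cmod h * ((b1 - a1) * (b2 - a2)) by exact: ler_wpM2r.
  split.
    have -> : q1 (z + h) * q2 (z + h) - q1 z * q2 z =
      q1 z * (q2 (z + h) - q2 z) + (q1 (z + h) - q1 z) * q2 z
      + (q1 (z + h) - q1 z) * (q2 (z + h) - q2 z) by ring.
    apply: le_trans (cmodD _ _) _; rewrite Normc.normcM.
    have := cmodD (q1 z * (q2 (z + h) - q2 z)) ((q1 (z + h) - q1 z) * q2 z).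
    rewrite !Normc.normcM; lra.
  have -> : q1 (z + h) * q2 (z + h) - q1 z * q2 z -
      h * (d1 * q2 z + q1 z * d2) =
      q1 z * (q2 (z + h) - q2 z - h * d2) + (q1 (z + h) - q1 z - h * d1) * q2 z
      + (q1 (z + h) - q1 z) * (q2 (z + h) - q2 z) by ring.
  apply: le_trans (cmodD _ _) _; rewrite Normc.normcM.
  have := cmodD (q1 z * (q2 (z + h) - q2 z - h * d2))
    ((q1 (z + h) - q1 z - h * d1) * q2 z).
  rewrite !Normc.normcM; lra.
Qed.

Lemma jet_boundX z q d a b n : jet_bound z q d a b ->
  exists e, jet_bound z (fun y => q y ^+ n) e (a ^+ n) (b ^+ n).
Proof.
move=> J; elim: n => [|n [e IHn]]; first by exists 0; exact: jet_bound1.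
exists (d * q z ^+ n + q z * e); rewrite !exprS.
rewrite (_ : (fun y => _) = (fun y => q y * q y ^+ n)).
  exact: jet_boundM.
by apply/funext => y; rewrite exprS.
Qed.

End Jets.

Section Products.
Variable R : realType.
Local Set Implicit Arguments.
Local Unset Strict Implicit.
Variables (q : nat -> R[i] -> R[i]) (A : nat -> R -> R).

Let P N (z : R[i]) : R[i]^o := \prod_(1 <= m < N.+1) q m z.
Let G N (x : R) : R := \prod_(1 <= m < N.+1) A m x.

Hypothesis q_jet : forall m z, (0 < m)%N ->
  exists d, jet_bound z (q m) d (A m (cmod z)) (A m (cmod z + 1)).
Hypothesis G_cvg : forall x, 0 <= x -> cvgn (G^~ x).

(** The derivatives [D N] of the partial products converge because their
    increments are dominated by those of the majorant at |z| + 1. *)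
Lemma product_jet_bound z : exists D : nat -> R[i]^o,
  [/\ forall N, jet_bound z (P N) (D N) (G N (cmod z)) (G N (cmod z + 1)),
    forall N, cmod (P N.+1 z - P N z) <= G N.+1 (cmod z) - G N (cmod z)
  & forall N, cmod (D N.+1 - D N) <=
      G N.+1 (cmod z + 1) - G N (cmod z + 1)].
Proof.
have /choice[d dP] : forall m, exists d, jet_bound z (q m.+1) d
    (A m.+1 (cmod z)) (A m.+1 (cmod z + 1)) by move=> m; exact: q_jet.
pose D := fix D N : R[i]^o :=
  if N is N'.+1 then D N' * q N z + P N' z * d N' else 0.
have PS N y : P N.+1 y = P N y * q N.+1 y by rewrite /P big_nat_recr.
have GS N y : G N.+1 y = G N y * A N.+1 y by rewrite /G big_nat_recr.
have J N : jet_bound z (P N) (D N) (G N (cmod z)) (G N (cmod z + 1)).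
  elim: N => [|N IHN].
    have -> : P 0 = (fun=> 1) by apply/funext => y; rewrite /P big_geq.
    by rewrite /G !big_geq//; exact: jet_bound1.
  have -> : P N.+1 = (fun y => P N y * q N.+1 y) by apply/funext => y.
  by rewrite !GS; exact: jet_boundM.
exists D; split => // N.
  rewrite PS GS -[X in _ - X]mulr1 -[X in _ <= _ - X]mulr1 -!mulrBr.
  rewrite Normc.normcM ler_pM ?cmod_ge0 ?(jet_bound_le (J N))//.
  by have [_ + _ _] := dP N.
have -> : D N.+1 - D N = D N * (q N.+1 z - 1) + P N z * d N by rewrite /=; ring.
apply: le_trans (cmodD _ _) _; rewrite !Normc.normcM GS.
have [/andP[a1 ab] Q dd _] := dP N.
have P_le := jet_bound_le (J N).
have [/andP[a1' ab'] _ DD _] := J N.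
have X1 := ler_pM (cmod_ge0 _) (cmod_ge0 _) DD Q.
have X2 := ler_pM (cmod_ge0 _) (cmod_ge0 _) P_le dd.
have X3 : 0 <= (G N (cmod z + 1) - G N (cmod z)) * (A N.+1 (cmod z + 1) - A N.+1 (cmod z)).
  by rewrite mulr_ge0 ?subr_ge0.
have X4 : 0 <= G N (cmod z) * (A N.+1 (cmod z) - 1).
  by rewrite mulr_ge0 ?subr_ge0//; lra.
lra.
Qed.

Lemma product_cvg z : cvg (P N z @[N --> \oo]).
Proof.
have [D [_ PG _]] := product_jet_bound z.
by apply: (majorized_cvg PG); apply: G_cvg; exact: cmod_ge0.
Qed.

(** The remainder estimate |P_N(z+h) - P_N(z) - h D_N| <= |h|^2 K_N passes to the
    limit and bounds the difference quotient minus the limit derivative by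
    |h| K. *)
Lemma product_derivable (z : R[i]^o) :
  derivable ((fun y => lim (P N y @[N --> \oo])) : R[i]^o -> R[i]^o) z 1.
Proof.
have [D [J PG DG]] := product_jet_bound z.
have z1 : 0 <= cmod z + 1 by rewrite addr_ge0 ?cmod_ge0.
have Dcvg : cvg (D N @[N --> \oo]).
  exact: (majorized_cvg DG (G_cvg z1)).
set f := fun y : R[i]^o => lim (P N y @[N --> \oo]) : R[i]^o.
have fP (y : R[i]) : P N y @[N --> \oo] --> f y by have := @product_cvg y.
set d := lim (D N @[N --> \oo]).
pose K : R := limn (fun N => G N (cmod z + 1) - G N (cmod z)).
have Kcvg : G N (cmod z + 1) - G N (cmod z) @[N --> \oo] --> K.
  by apply: is_cvgB; [exact: G_cvg|apply: G_cvg; exact: cmod_ge0].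
have rem h : cmod h <= 1 ->
    cmod (f (z + h) - f z - h * d) <= cmod h ^+ 2 * K.
  move=> h1.
  have c1 : P N (z + h) - P N z - h * D N @[N --> \oo] -->
      (f (z + h) - f z - h * d : R[i]^o).
    apply: cvgB; [apply: (cvgB (fP (z + h)) (fP z))|
      apply: cvgM; [exact: cvg_cst|exact: Dcvg]].
  have c2 : cmod h ^+ 2 * (G N (cmod z + 1) - G N (cmod z)) @[N --> \oo] -->
      cmod h ^+ 2 * K by apply: cvgM; [exact: cvg_cst|exact: Kcvg].
  apply: (ler_cvg_to (cvg_cmod c1) c2).
  by near=> N; have [_ _ _ /(_ _ h1)[]] := J N.
apply/cvg_ex; exists d; apply/cvg_cmodP.
apply: (@squeeze_cvgr _ _ _ _ (cst 0) (fun h : R[i]^o => cmod h * K)).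
- near=> h.
  have h0 : h != 0 by near: h; exact: nbhs_dnbhs_neq.
  have h1 : cmod h <= 1.
    have : `|h| <= 1 by near: h; exact: dnbhs0_le.
    by rewrite -(@normr_le_cmod _ _ 1).
  rewrite cmod_ge0 /=.
  have ch0 : 0 < cmod h.
    by rewrite lt_def cmod_ge0 andbT; apply: contra h0 => /eqP/Normc.eq0_normc->.
  rewrite -(ler_pM2l ch0) -Normc.normcM mulrA -expr2.
  have -> : h * (h^-1 *: (f (h *: 1 + z) - f z) - d) =
     f (z + h) - f z - h * d.
    rewrite mulrBr; congr (_ - _); rewrite -[_ *: _]/(_ * _) mulrA divff// mul1r.
    by rewrite -[h *: 1]/(h * 1) mulr1 (addrC h).
  exact: rem.
- exact: cvg_cst.
- rewrite -[X in _ --> X](mul0r K); apply: cvgM; last exact: cvg_cst.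
  apply: cvg_within_filter.
  have := @cvg_cmod R _ (nbhs (0 : R[i]^o)) _ id 0 cvg_id.
  rewrite Normc.normc0 => H; exact: H.
Unshelve. all: by end_near. Qed.

End Products.

(** * Real powers *)

Section RealPowers.
Variable R : realType.
Local Set Implicit Arguments.
Local Unset Strict Implicit.
Implicit Types x y a : R.

Lemma powRVl x a : 0 <= x -> x^-1 `^ a = x `^ (- a).
Proof. by move=> x0; rewrite -powR_inv1// -powRrM mulN1r. Qed.

Lemma ge1_powR x a : 1 <= x -> 0 <= a -> 1 <= x `^ a.
Proof. by move=> x1 a0; rewrite -[leLHS](powRr0 x) ler_powR. Qed.

Lemma gt1_powR x a : 1 < x -> 0 < a -> 1 < x `^ a.
Proof.
move=> x1 a0; rewrite /powR gt_eqF; last exact: lt_trans x1.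
by rewrite expR_gt1 mulr_gt0// ln_gt0.
Qed.

Lemma ler_powRN x y a : 0 < x -> x <= y -> 0 <= a -> y `^ (- a) <= x `^ (- a).
Proof.
move=> x0 xy a0; have y0 := lt_le_trans x0 xy.
rewrite !powRN lef_pV2 ?posrE ?powR_gt0//.
by rewrite ge0_ler_powR// nnegrE ltW.
Qed.

(** For x <= 1 one has x <= x^a; for x > 1, 1 + x <= 2x <= exp (1 + log x) and
    log x <= x^a / a. *)
Lemma le_1D_expR_powR x a : 0 <= x -> 0 < a <= 1 ->
  1 + x <= expR ((1 + a^-1) * x `^ a).
Proof.
move=> x0 /andP[a0 a1].
have ia0 : 0 < a^-1 by rewrite invr_gt0.
have [x1|x1] := leP x 1.
  apply: le_trans (expR_ge1Dx x) _; rewrite ler_expR.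
  move: x0; rewrite le_eqVlt => /predU1P[<-|x0].
    by rewrite mulr_ge0 ?powR_ge0// addr_ge0// ltW.
  have : x <= x `^ a by rewrite ger1_powR// x0.
  have := mulr_ge0 (ltW ia0) (powR_ge0 x a); lra.
have xgt0 : 0 < x by lra.
have e2 : 2 <= expR (1 : R) by have := expR_ge1Dx (1 : R); lra.
have xa0 : 0 < x `^ a by rewrite powR_gt0.
have lnx : ln x <= a^-1 * x `^ a.
  have -> : ln x = a^-1 * ln (x `^ a) by rewrite ln_powR mulrA mulVf ?mul1r ?gt_eqF.
  by rewrite ler_pM2l// ltW// ln_sublinear.
have xa1 : 1 <= x `^ a by rewrite ge1_powR ?ltW.
apply: (@le_trans _ _ (expR 1 * expR (ln x))).
  rewrite lnK ?posrE//.
  by apply: (@le_trans _ _ (2 * x)); [lra|rewrite ler_pM2r].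
by rewrite -expRD ler_expR; lra.
Qed.

End RealPowers.

(** * The real majorant of an admissible product *)

Section Admissible.
Variables (R : realType) (eps r : R^nat).
Local Set Implicit Arguments.
Local Unset Strict Implicit.
Hypothesis adm : admissible eps r.

Definition multiplicity m : nat := Num.truncn (r m `^ eps m).
Local Notation n := multiplicity.

Lemma eps_gt0 m : (0 < m)%N -> 0 < eps m.
Proof. by have [[+ _ _ _] _ _ _ _] := adm; exact. Qed.

Lemma eps_lt1 m : (0 < m)%N -> eps m < 1.
Proof.
have [[_ e _ e1] _ _ _ _] := adm.
by move=> m0; exact: le_lt_trans (e _ _ _ m0) e1.
Qed.

Lemma zero_ge4 m : (0 < m)%N -> 4 <= r m.
Proof.
have [_ [rlt r1] _ _ _] := adm; move=> m0; apply: le_trans r1 _.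
move: m0; rewrite leq_eqVlt => /predU1P[<-//|m1].
by rewrite ltW// rlt.
Qed.

Lemma zero_gt0 m : (0 < m)%N -> 0 < r m.
Proof. by move=> /zero_ge4; lra. Qed.

Lemma zero_le i j : (0 < i)%N -> (i <= j)%N -> r i <= r j.
Proof.
have [_ [rlt _] _ _ _] := adm; move=> i0.
by rewrite leq_eqVlt => /predU1P[->//|ij]; rewrite ltW// rlt.
Qed.

Lemma multiplicityE m : (0 < m)%N -> (n m)%:R = r m `^ eps m.
Proof.
have [_ _ rn _ _] := adm; move=> /rn[k _ rk].
by rewrite /n rk natrK.
Qed.

Lemma multiplicity_gt0 m : (0 < m)%N -> (0 < n m)%N.
Proof.
by move=> m0; rewrite -(ltr0n R) multiplicityE// powR_gt0// zero_gt0.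
Qed.

Lemma multiplicity_le_zero m : (0 < m)%N -> (n m)%:R <= r m.
Proof.
move=> m0; rewrite multiplicityE// ler1_powR// ?ltW ?eps_lt1//.
by have := zero_ge4 m0; lra.
Qed.

Lemma multiplicity_growth m : (0 < m)%N -> r m ^+ m.+1 <= (n m.+1)%:R.
Proof. by have [_ _ _ rn _] := adm; move=> m0; rewrite multiplicityE// rn. Qed.

(** Each zero is at least the square of the preceding one, since
    r_(m+1) >= n_(m+1) >= r_m^(m+1). *)
Lemma zero_ge_exp2 m : (0 < m)%N -> 2 ^+ m <= r m.
Proof.
case: m => // m _; elim: m => [|m IHm].
  by have := @zero_ge4 1 isT; rewrite expr1; lra.
apply: le_trans (multiplicity_le_zero (ltn0Sn _)).
apply: le_trans (multiplicity_growth (ltn0Sn _)).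
have r4 := @zero_ge4 m.+1 isT.
apply: (@le_trans _ _ (r m.+1 ^+ 2)).
  rewrite exprS expr2 ler_pM ?exprn_ge0//; lra.
by rewrite ler_weXn2l//; lra.
Qed.

Lemma eps_near0 a : 0 < a -> exists M, forall m, (M < m)%N -> eps m <= a.
Proof.
have [[_ _ e _] _ _ _ _] := adm; move=> a0.
move/cvgrPdist_le : e => /(_ _ a0)[M _ H]; exists M => m Mm.
have := H m (ltnW Mm); rewrite /= sub0r normrN.
exact: le_trans (ler_norm _).
Qed.

(** As soon as eps_m <= a/2, the term r_m^(eps_m - a) is at most
    r_m^(-a/2) <= 2^(-am/2), the term of a geometric series. *)
Lemma exponent_of_convergence0 a : 0 < a -> exists B, forall N,
  \sum_(1 <= m < N.+1) (n m)%:R * r m `^ (- a) <= B.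
Proof.
move=> a0; have a20 : 0 < a / 2 by rewrite divr_gt0.
have [M eM] := eps_near0 a20.
(* the ratio of the dominating geometric series *)
pose q : R := 2 `^ (- (a / 2)).
have q0 : 0 < q by rewrite powR_gt0.
have q1 : q < 1.
  by rewrite /q powRN invf_lt1 ?powR_gt0// gt1_powR// ltr1n.
pose u m := (n m)%:R * r m `^ (- a).
pose S N := \sum_(1 <= m < N.+1) u m.
have SS N : S N.+1 = S N + u N.+1 by rewrite /S big_nat_recr.
have u0 m : 0 <= u m by rewrite mulr_ge0 ?powR_ge0.
have uq m : (M < m)%N -> u m <= q ^+ m.
  move=> Mm; have m0 : (0 < m)%N by exact: leq_ltn_trans Mm.
  have r0 := zero_gt0 m0; have r4 := zero_ge4 m0.
  rewrite /u multiplicityE// -powRD; last by rewrite (gt_eqF r0) implybT.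
  apply: (@le_trans _ _ (r m `^ (- (a / 2)))).
    rewrite ler_powR//; first by lra.
    by have := eM _ Mm; lra.
  rewrite /q -powR_mulrn ?powR_ge0// powRAC powR_mulrn//.
  by rewrite ler_powRN ?exprn_gt0 ?zero_ge_exp2// ltW.
(* M first terms, then a geometric tail with sum at most 1 / (1 - q) *)
have SM k : S (M + k)%N <= S M + (1 - q)^-1 * (1 - q ^+ k).
  elim: k => [|k IHk]; first by rewrite addn0 expr0 subrr mulr0 addr0.
  rewrite addnS SS.
  have : u (M + k).+1 <= q ^+ k.
    apply: le_trans (uq _ _) _; first by rewrite ltnS leq_addr.
    by rewrite ler_wiXn2l ?ltW// leqW// leq_addl.
  have -> : q ^+ k = (1 - q)^-1 * (q ^+ k - q ^+ k.+1).
    by rewrite exprSr; field; rewrite subr_eq0 gt_eqF.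
  by lra.
exists (S M + (1 - q)^-1) => N.
have SN : S N <= S (M + N)%N.
  elim: M {eM uq SM} => [|k IHk]; first by rewrite add0n.
  by rewrite addSn SS (le_trans IHk)// lerDl.
apply: le_trans SN _; apply: le_trans (SM N) _; rewrite lerD2l.
by rewrite ler_piMr ?invr_ge0 ?subr_ge0 ?(ltW q1)// gerBl exprn_ge0// ltW.
Qed.

Definition majorant N (x : R) : R :=
  \prod_(1 <= m < N.+1) (1 + x * (r m)^-1) ^+ n m.
Local Notation G := majorant.

Lemma majorant_factor_ge1 m x : (0 < m)%N -> 0 <= x ->
  1 <= (1 + x * (r m)^-1) ^+ n m.
Proof.
move=> m0 x0; rewrite exprn_ege1// lerDl mulr_ge0// invr_ge0.
by rewrite ltW ?zero_gt0.
Qed.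

Lemma majorant_ge1 N x : 0 <= x -> 1 <= G N x.
Proof.
move=> x0; elim: N => [|N IHN]; first by rewrite /G big_geq.
by rewrite /G big_nat_recr//= mulr_ege1// majorant_factor_ge1.
Qed.

Lemma majorant_nondecreasing x : 0 <= x -> nondecreasing_seq (G^~ x).
Proof.
move=> x0; apply/nondecreasing_seqP => N.
rewrite [leRHS]/G big_nat_recr//= ler_peMr ?majorant_factor_ge1//.
exact: le_trans (majorant_ge1 _ x0).
Qed.

(** Apply 1 + y <= exp (c y^a) to y = x / r_m in each factor; the resulting
    exponent is c x^a times the sum of n_m r_m^(-a). *)
Lemma majorant_le_expR a : 0 < a <= 1 -> exists2 B, 0 < B &
  forall N x, 0 <= x -> G N x <= expR (B * x `^ a).
Proof.
move=> a01; have /andP[a0 _] := a01.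
have [B HB] := exponent_of_convergence0 a0.
have c0 : 0 < 1 + a^-1 by rewrite addr_gt0 ?invr_gt0.
exists ((1 + a^-1) * (`|B| + 1)) => [|N x x0].
  by rewrite mulr_gt0// ltr_wpDl.
apply: (@le_trans _ _ (expR ((1 + a^-1) * x `^ a *
    \sum_(1 <= m < N.+1) (n m)%:R * r m `^ (- a)))); last first.
  rewrite ler_expR -!mulrA ler_pM2l// mulrC ler_wpM2r ?powR_ge0//.
  by apply: le_trans (HB N) _; have := ler_norm B; lra.
elim: N => [|N IHN].
  by rewrite /G !big_geq// mulr0 expR0.
have r0 := @zero_gt0 N.+1 isT.
rewrite /G big_nat_recr//= [in leRHS]big_nat_recr//= mulrDr expRD.
apply: ler_pM => //.
- exact: le_trans (majorant_ge1 _ x0).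
- exact: le_trans (majorant_factor_ge1 _ x0).
have xr0 : 0 <= x * (r N.+1)^-1 by rewrite mulr_ge0// invr_ge0 ltW.
have -> : (1 + a^-1) * x `^ a * ((n N.+1)%:R * r N.+1 `^ (- a)) =
    (n N.+1)%:R * ((1 + a^-1) * (x * (r N.+1)^-1) `^ a).
  rewrite powRM ?invr_ge0 ?(ltW r0)// powRVl ?(ltW r0)//; ring.
rewrite expRM_natl lerXn2r ?nnegrE ?expR_ge0//; first by lra.
exact: le_1D_expR_powR.
Qed.

Lemma majorant_cvg x : 0 <= x -> cvgn (G^~ x).
Proof.
move=> x0; have [|B _ HB] := @majorant_le_expR 1; first by rewrite ltr01 lexx.
apply: nondecreasing_is_cvgn; first exact: majorant_nondecreasing.
by exists (expR (B * x `^ 1)) => _ [N _ <-]; exact: HB.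
Qed.

End Admissible.

(** * The infinite product: maximum modulus, transcendence, order *)

Section InfiniteProduct.
Variables (R : realType) (eps r : R^nat).
Local Set Implicit Arguments.
Local Unset Strict Implicit.
Hypothesis adm : admissible eps r.
Local Notation n := (multiplicity eps r).
Local Notation G := (majorant eps r).
Local Notation P := (partial_product eps r).
Local Notation f := (infinite_product eps r).

Definition majorant_limit (x : R) : R := limn (G^~ x).
Local Notation F := majorant_limit.

Lemma factor_jet m (z : R[i]) : (0 < m)%N -> exists d,
  jet_bound z (fun y => (1 - y / (r m)%:C%C) ^+ n m) d
    ((1 + cmod z * (r m)^-1) ^+ n m) ((1 + (cmod z + 1) * (r m)^-1) ^+ n m).
Proof.
move=> m0; have r0 := zero_gt0 adm m0.
have [d dP] := jet_boundX (n m) (jet_bound_linear z (- ((r m)^-1)%:C%C)).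
exists d; move: dP; rewrite cmodN cmodR ger0_norm ?invr_ge0 ?(ltW r0)//.
rewrite (_ : (fun y => _) = fun y => (1 - y / (r m)%:C%C) ^+ n m)//.
by apply/funext => y; rewrite mulrN fmorphV.
Qed.

Lemma partial_product_cvg (z : R[i]) : cvg (P N z @[N --> \oo]).
Proof.
apply: (product_cvg factor_jet).
exact: (majorant_cvg adm).
Qed.

Lemma infinite_product_entire : entire f.
Proof.
move=> z; apply: (product_derivable factor_jet).
exact: (majorant_cvg adm).
Qed.

Lemma partial_product_le N (z : R[i]) : cmod (P N z) <= G N (cmod z).
Proof.
have [D [J _ _]] := @product_jet_bound _ _
  (fun m x => (1 + x * (r m)^-1) ^+ n m) factor_jet z.
exact: jet_bound_le (J N).
Qed.

Lemma cmod_partial_product_cvg (z : R[i]) :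
  cmod (P N z) @[N --> \oo] --> (cmod (f z) : R).
Proof. exact: cvg_cmod (partial_product_cvg (z := z)). Qed.

Lemma majorant_le_limit N x : 0 <= x -> G N x <= F x.
Proof.
move=> x0; apply: (@nondecreasing_cvgn_le _ (G^~ x)).
  exact: (majorant_nondecreasing adm).
exact: (majorant_cvg adm).
Qed.

Lemma infinite_product_neg x : 0 <= x -> cmod (f (- x%:C%C)) = F x.
Proof.
move=> x0.
have PG N : cmod (P N (- x%:C%C)) = G N x.
  have -> : P N (- x%:C%C) = (G N x)%:C%C.
    rewrite /partial_product /majorant rmorph_prod; apply: eq_bigr => m _.
    by rewrite rmorphXn rmorphD rmorph1 rmorphM fmorphV mulNr opprK.
  rewrite cmodR ger0_norm//.
  exact: le_trans (majorant_ge1 adm N x0).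
have H := cmod_partial_product_cvg (z := - x%:C%C).
move: H; under eq_fun do rewrite PG.
by move=> /cvg_lim <-.
Qed.

Lemma infinite_product_le (z : R[i]) : cmod (f z) <= F (cmod z).
Proof.
apply: (ler_cvg_to (cmod_partial_product_cvg (z := z))).
  exact: (majorant_cvg adm (cmod_ge0 z)).
by near=> N; exact: partial_product_le.
Unshelve. all: by end_near. Qed.

(** The maximum on a circle is attained at its negative point, since all zeros
    are positive. *)
Lemma max_modulusE x : 0 <= x -> max_modulus f x = F x.
Proof.
move=> x0; apply: xget_subset1.
  split.
    exists (- x%:C%C); last exact: infinite_product_neg.
    have cx : cmod (- x%:C%C) = x by rewrite cmodN cmodR ger0_norm.
    exact: cx.
  by move=> _ [z /= <- <-]; exact: infinite_product_le.
move=> a b [ca ua] [cb ub]; apply/eqP; rewrite eq_le.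
by rewrite (ub _ ca) (ua _ cb).
Qed.

(** When the set of values has no least element, the left side is the default
    value 0, and the inequality holds because a modulus is nonnegative. *)
Lemma min_modulus_le t : 0 <= t -> min_modulus f t <= cmod (f t%:C%C).
Proof.
move=> t0; rewrite /min_modulus; case: xgetP => [y _ [_ yl]|_].
  have ct : cmod t%:C%C = t by rewrite cmodR ger0_norm.
  by apply: yl; exists t%:C%C; [exact: ct|].
exact: cmod_ge0.
Qed.

Lemma infinite_product_root m : (0 < m)%N -> f (r m)%:C%C = 0.
Proof.
move=> m0; apply: (@norm_lim_near_cst _ (R[i]^o)).
near=> N; rewrite /partial_product.
have mN : (m < N.+1)%N by rewrite ltnS; near: N; exact: nbhs_infty_ge.
rewrite (bigD1_seq m) ?iota_uniq ?mem_index_iota ?m0//=.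
rewrite divff ?subrr ?expr0n; last first.
  by rewrite fmorph_eq0 gt_eqF// (zero_gt0 adm).
have := multiplicity_gt0 adm m0; rewrite /multiplicity => h.
by rewrite gtn_eqF// mul0r.
Unshelve. all: by end_near. Qed.

Lemma infinite_product0 : f 0 = 1.
Proof.
apply: (@norm_lim_near_cst _ (R[i]^o)); near=> N.
by rewrite /partial_product big1// => m _; rewrite mul0r subr0 expr1n.
Unshelve. all: by end_near. Qed.

Lemma infinite_product_transcendental : transcendental_entire f.
Proof.
split; first exact: infinite_product_entire.
move=> [p fp].
have p0 : p != 0.
  apply/eqP => p0; have := infinite_product0; rewrite fp p0 horner0 => /esym/eqP.
  by rewrite oner_eq0.
pose s := [seq (r m.+1)%:C%C | m <- iota 0 (size p)].
have : (size s < size p)%N.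
  apply: max_poly_roots => //.
    apply/allP => _ /mapP[m _ ->]; apply/rootP.
    by rewrite -fp infinite_product_root.
  rewrite map_inj_uniq ?iota_uniq// => i j /= [] rij.
  have [_ [rlt _] _ _ _] := adm.
  have [ij|ij|//] := ltngtP i j.
    by have := rlt i.+1 j.+1 isT ij; rewrite rij ltxx.
  by have := rlt j.+1 i.+1 isT ij; rewrite rij ltxx.
by rewrite size_map size_iota ltnn.
Qed.

Lemma majorant_limit_le_expR a : 0 < a <= 1 -> exists2 B, 0 < B &
  forall x, 0 <= x -> F x <= expR (B * x `^ a).
Proof.
move=> /(majorant_le_expR adm)[B B0 GB]; exists B => // x x0.
apply: limr_le; first exact: (majorant_cvg adm).
by near=> N; exact: GB.
Unshelve. all: by end_near. Qed.

Lemma majorant_limit_ge_linear x : 0 <= x -> 1 + x * (r 1%N)^-1 <= F x.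
Proof.
move=> x0; apply: le_trans (@majorant_le_limit 1 x x0).
rewrite /majorant big_nat1 -[leLHS]expr1.
rewrite ler_weXn2l ?(multiplicity_gt0 adm)//.
by rewrite lerDl mulr_ge0// invr_ge0 ltW// (zero_gt0 adm).
Qed.

(** The upper bound uses F(x) <= exp (B x^a) with a <= e/2, the factor B
    being absorbed by the other half of e; the lower bound holds because
    F(x) >= exp 1 for large x. *)
Lemma infinite_product_order0 : growth_order f = 0%E.
Proof.
have r1 : 0 < r 1%N by rewrite (zero_gt0 adm).
pose g (x : R) := (lne (lne (max_modulus f x)%:E) / lne x%:E)%E.
(* beyond x0 all the logarithms are those of positive reals *)
pose x0 := Num.max 1 (r 1%N * expR 1).
have big x : x0 < x -> [/\ 1 < x, 1 <= ln (F x) &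
    g x = (ln (ln (F x)) / ln x)%:E].
  rewrite gt_max => /andP[x1 xr].
  have x0' : 0 <= x by lra.
  have Fe : expR 1 <= F x.
    apply: le_trans (majorant_limit_ge_linear x0').
    rewrite ler_wpDl// -ler_pdivrMr ?invr_gt0// invrK mulrC; exact: ltW.
  have F0 : 0 < F x by exact: lt_le_trans (expR_gt0 _) Fe.
  have lnF : 1 <= ln (F x).
    by rewrite -[leLHS](expRK (1 : R)) ler_ln ?posrE ?expR_gt0.
  have lnx : 0 < ln x by exact: ln_gt0.
  split => //; rewrite /g max_modulusE// (lne_EFin F0).
  rewrite (lne_EFin (lt_le_trans ltr01 lnF)) (lne_EFin (lt_trans ltr01 x1)).
  by rewrite inver gt_eqF.
rewrite /growth_order limf_esupE; apply/eqP; rewrite eq_le; apply/andP; split.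
  apply/lee_addgt0Pr => e e0; rewrite add0e.
  pose a := Num.min 1 (e / 2).
  have a01 : 0 < a <= 1.
    by rewrite /a lt_min ltr01 ge_min lexx divr_gt0.
  have ae : a <= e / 2 by rewrite /a ge_min lexx orbT.
  have [B B0 FB] := majorant_limit_le_expR a01.
  pose x1 := Num.max x0 (expR (ln B * 2 / e)).
  apply: (@le_trans _ _ (ereal_sup (g @` [set x | x1 < x]))).
    apply: ereal_inf_lbound; exists [set x | x1 < x] => //.
    by exists x1; split; [exact: num_real|].
  apply: ge_ereal_sup => _ [x /= + <-].
  rewrite gt_max => /andP[/big[x_1 lnF ->]] xB.
  have xp : 0 < x by lra.
  have lnx : 0 < ln x by exact: ln_gt0.
  rewrite lee_fin ler_pdivrMr//.
  have lnB : ln B * 2 / e <= ln x.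
    by rewrite -[leLHS]expRK ler_ln ?posrE ?expR_gt0// ltW.
  have lnB' : ln B <= e / 2 * ln x.
    have -> : ln B = e / 2 * (ln B * 2 / e) by field; rewrite gt_eqF.
    by rewrite ler_pM2l// divr_gt0.
  have F0 : 0 < F x.
    by apply: lt_le_trans (majorant_limit_ge_linear (ltW xp)); rewrite ltr_pwDl// divr_ge0// ltW.
  have H1 : ln (F x) <= B * x `^ a.
    rewrite -[leRHS]expRK ler_ln ?posrE ?expR_gt0//.
    exact: FB (ltW xp).
  have H2 : ln (ln (F x)) <= ln B + a * ln x.
    rewrite -ln_powR -lnM ?posrE ?powR_gt0//.
    by rewrite ler_ln ?posrE ?mulr_gt0 ?powR_gt0//; lra.
  have H3 : a * ln x <= e / 2 * ln x by rewrite ler_pM2r.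
  by lra.
apply: le_ereal_inf_tmp => _ [A [M [_ AM]] <-].
pose x := Num.max M x0 + 1.
have : Num.max M x0 < x by rewrite ltrDl.
rewrite gt_max => /andP[Mx /big[x1 lnF gx]].
apply: (@le_trans _ _ (g x)).
  by rewrite gx lee_fin divr_ge0// ln_ge0// ltW.
by apply: ereal_sup_ubound; exists x => //; exact: AM.
Qed.

End InfiniteProduct.

(** * Real inequalities behind the jump of the minimum modulus *)

Section RealInequalities.
Variable R : realType.
Local Set Implicit Arguments.
Local Unset Strict Implicit.

Lemma expR_ge_sqr (u x : R) : 0 <= x -> 2 * x <= u -> x ^+ 2 <= expR u.
Proof.
move=> x0 xu; have -> : u = u / 2 + u / 2 by field.
rewrite expRD -expr2 lerXn2r ?nnegrE ?expR_ge0//.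
by have := expR_ge1Dx (u / 2); lra.
Qed.

Lemma ln2_ge : 2^-1 <= ln (2 : R).
Proof.
have := @le_ln1Dx R (- 2^-1); rewrite (_ : 1 + - 2^-1 = 2^-1); last by lra.
by rewrite lnV ?posrE// lerN2; apply; lra.
Qed.

(** When [m <= 0] the quotient is -oo. *)
Lemma lne_ratio_lt (m M c : R) : 0 < ln M -> 0 < M ->
  (0 < m -> ln m < c * ln M) -> (lne m%:E / lne M%:E < c%:E)%E.
Proof.
move=> lnM M0 mc; rewrite (lne_EFin M0) inver gt_eqF//.
have [m0|m0] := ltP 0 m.
  by rewrite (lne_EFin m0) lte_fin ltr_pdivrMr// mc.
rewrite le0_lneNy ?lee_fin// gt0_mulNye ?ltNyr//.
by rewrite lte_fin invr_gt0.
Qed.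

(** The left side bounds log m(t) for log t = y, and [N * (x / L - X)] bounds
    log M(rho) from below; [a] stands for C / (log rho)^delta.
    The right side exceeds N (1 - e/2) x, which settles y <= (1 - e/2) x; for
    larger y the exponential is at least exp (e x / 2) >= N x, and the left side
    is negative. *)
Lemma jump_inequality (N x y X e a L : R) :
  1 <= N -> 0 < x -> y < x -> 0 < e < 1 -> 0 <= a < e / 4 -> 0 <= X ->
  0 < L -> L * X <= e / 4 * x -> N * x <= expR (e * x / 2) ->
  N * y - expR (e * x + y - x) < L * (1 - a) * (N * (x / L - X)).
Proof.
move=> N1 x0 yx /andP[e0 e1] /andP[a0 ae] X0 L0 LX Nx.
have -> : L * (1 - a) * (N * (x / L - X)) = N * ((1 - a) * (x - L * X)).
  by field; rewrite gt_eqF.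
have N0 : 0 < N by lra.
have ax : a * x < e / 4 * x by rewrite ltr_pM2r.
have aLX : 0 <= a * (L * X) by rewrite mulr_ge0// mulr_ge0// ltW.
have ex : e * x < x by rewrite gtr_pMl.
have rhs : (1 - e / 2) * x < (1 - a) * (x - L * X) by lra.
have [yle|ygt] := leP y ((1 - e / 2) * x).
  have : N * y < N * ((1 - a) * (x - L * X)).
    by rewrite ltr_pM2l//; exact: le_lt_trans rhs.
  have := expR_gt0 (e * x + y - x); lra.
have : expR (e * x / 2) <= expR (e * x + y - x) by rewrite ler_expR; lra.
have : N * y < N * x by rewrite ltr_pM2l.
have : 0 < N * ((1 - a) * (x - L * X)).
  by rewrite mulr_gt0//; apply: lt_trans rhs; rewrite mulr_gt0//; lra.
lra.
Qed.

End RealInequalities.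

(** * Existence of admissible sequences *)

Section Existence.
Variable R : realType.
Local Set Implicit Arguments.
Local Unset Strict Implicit.

(** Take eps_k = 1/(k+1) and r_k = 2^((k+1) a_k) with a_k = (k+1)^(2k), so that
    r_k^eps_k = 2^a_k and log r_k >= (k+1)^(2k), whose k-th root (k+1)^2
    outweighs eps_k. *)
Lemma admissible_exists : exists eps r : R^nat, admissible eps r.
Proof.
pose a (k : nat) := (k.+1 ^ (2 * k))%N.
pose eps (k : nat) : R := k.+1%:R^-1.
pose r (k : nat) : R := 2 ^+ (k.+1 * a k).
have rE k : r k `^ eps k = 2 ^+ a k.
  have e2 : (2 ^+ k.+1) `^ eps k = 2 :> R.
    by rewrite -powR_mulrn// -powRrM divff ?pnatr_eq0// powRr1.
  by rewrite /r exprM -[X in X `^ _]powR_mulrn ?exprn_ge0// powRAC e2 powR_mulrn.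
have a_mono m k : (m <= k)%N -> (a m <= a k)%N.
  move=> mk; rewrite /a; apply: (@leq_trans (k.+1 ^ (2 * m))).
    by case: (posnP m) => [->//|m0]; rewrite leq_exp2r ?muln_gt0.
  by rewrite leq_pexp2l// leq_mul2l mk.
have a0 k : (0 < a k)%N by rewrite expn_gt0.
have ln2 := ln2_ge R.
exists eps, r; split.
- split.
  + by move=> m _; rewrite invr_gt0 ltr0n.
  + by move=> m k _ mk; rewrite lef_pV2 ?posrE ?ltr0n// ler_nat ltnS.
  + exact: cvg_harmonic.
  + by rewrite /eps invf_lt1 ?ltr0n// ltr1n.
- split.
    move=> m k _ mk; rewrite /r ltr_eXn2l ?ltr1n//.
    apply: (@leq_trans (k.+1 * a m)); first by rewrite ltn_pmul2r.
    by rewrite leq_mul2l a_mono ?orbT// ltnW.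
  rewrite /r /a -natrX ler_nat.
  by apply: (@leq_trans (2 ^ 2)) => //; rewrite leq_exp2l.
- move=> m _; exists (2 ^ a m)%N; first by rewrite expn_gt0.
  by rewrite rE natrX.
- move=> k k0; rewrite rE /r -exprM ler_weXn2l ?ler1n//.
  rewrite /a mulnAC mulnn -expnD.
  have -> : (2 + 2 * k = 2 * k.+1)%N by rewrite mulnS.
  by rewrite leq_exp2r.
apply/cvgryPge => B; near=> k.
have k0 : (0 < k)%N by near: k; exact: nbhs_infty_gt.
have Bk : B <= k%:R by near: k; exact: nbhs_infty_ger.
have lnr : k.+1%:R ^+ 2 ^+ k <= ln (r k).
  rewrite /r lnXn// -[ln _ *+ _]mulr_natl natrM /a natrX exprM.
  have : 1 <= k.+1%:R * ln (2 : R).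
    apply: (@le_trans _ _ (2 * 2^-1)); first by lra.
    by rewrite ler_pM// ?invr_ge0// ler_nat.
  have : 0 <= (k.+1%:R ^+ 2 ^+ k : R) by rewrite !exprn_ge0.
  set p := _ ^+ k => p0 h.
  by rewrite mulrAC ler_peMl.
have h : (k.+1%:R ^+ 2 : R) <= ln (r k) `^ k%:R^-1.
  have -> : k.+1%:R ^+ 2 = (k.+1%:R ^+ 2 ^+ k) `^ k%:R^-1 :> R.
    rewrite -[_ ^+ 2 ^+ k]powR_mulrn ?exprn_ge0// -powRrM divff ?pnatr_eq0 -?lt0n//.
    by rewrite powRr1// exprn_ge0.
  apply: ge0_ler_powR => //.
  - by rewrite nnegrE !exprn_ge0.
  - by rewrite nnegrE; apply: le_trans lnr; rewrite !exprn_ge0.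
apply: (@le_trans _ _ (k.+1%:R^-1 * k.+1%:R ^+ 2)); last by rewrite ler_pM2l ?invr_gt0.
rewrite expr2 mulrA mulVf ?pnatr_eq0// mul1r (le_trans Bk)// ler_nat.
exact: leqnSn.
Unshelve. all: by end_near. Qed.

End Existence.

(** * The minimum modulus just before a zero *)

Section MinimumModulus.
Variables (R : realType) (eps r : R^nat).
Local Set Implicit Arguments.
Local Unset Strict Implicit.
Hypothesis adm : admissible eps r.
Local Notation n := (multiplicity eps r).
Local Notation F := (majorant_limit eps r).
Local Notation P := (partial_product eps r).
Local Notation f := (infinite_product eps r).

(** Number of zeros in the closed disc of radius [r j], with multiplicity. *)
Definition zero_count j : nat := \sum_(1 <= m < j.+1) n m.
Local Notation S := zero_count.

Lemma zero_count_gt0 j : (0 < j)%N -> (0 < S j)%N.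
Proof.
by case: j => // j _; rewrite /S big_nat_recr//= addn_gt0 (multiplicity_gt0 adm) ?orbT.
Qed.

Lemma zero_count_le j : (0 < j)%N -> (S j)%:R <= r j ^+ 2.
Proof.
move=> j0; have rj := zero_ge_exp2 adm j0.
apply: (@le_trans _ _ (j%:R * r j)); last first.
  rewrite expr2 ler_pM2r ?(zero_gt0 adm)//; apply: le_trans rj.
  by rewrite -natrX ler_nat ltnW// ltn_expl.
rewrite /S natr_sum.
apply: (@le_trans _ _ (\sum_(1 <= m < j.+1) r j)).
  apply: ler_sum_nat => m /andP[m0 mj].
  by apply: le_trans (multiplicity_le_zero adm m0) _; exact: (zero_le adm).
by rewrite sumr_const_nat subn1 mulr_natl.
Qed.

(** Each of the zeros up to [r j] contributes a factor at least x / r_j, and the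
    others contribute factors at least 1. *)
Lemma majorant_limit_ge_pow j x : (0 < j)%N -> 0 < x ->
  (x / r j) ^+ S j <= F x.
Proof.
move=> j0 x0; apply: le_trans (majorant_le_limit adm j (ltW x0)).
rewrite /S -prodrXr /majorant big_nat_cond [leRHS]big_nat_cond.
apply: ler_prod => m; rewrite andbT => /andP[m0 mj].
have rm := zero_gt0 adm m0; have rj := zero_gt0 adm j0.
have xj : 0 <= x / r j by rewrite divr_ge0 ?ltW.
rewrite exprn_ge0//= lerXn2r ?nnegrE//.
  by rewrite addr_ge0// mulr_ge0 ?invr_ge0 ?ltW.
rewrite -[leLHS]add0r lerD// ler_pM2l// lef_pV2 ?posrE//.
exact: (zero_le adm).
Qed.

Lemma partial_product_real N t : P N t%:C%C =
  (\prod_(1 <= m < N.+1) (1 - t / r m) ^+ n m)%:C%C.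
Proof.
rewrite /partial_product rmorph_prod; apply: eq_bigr => m _.
by rewrite rmorphXn rmorphB rmorph1 rmorphM fmorphV.
Qed.

(** Each zero before [r j.+1] contributes a factor at most [t], the zero
    [r j.+1] itself a factor at most exp (-t / r_(j+1)), and the later ones
    factors at most 1. *)
Lemma infinite_product_near_zero j t : 1 <= t < r j.+1 ->
  cmod (f t%:C%C) <= t ^+ S j * expR (- ((n j.+1)%:R * (t / r j.+1))).
Proof.
move=> /andP[t1 tr]; have t0 : 0 < t by lra.
pose h m := `|1 - t / r m| ^+ n m.
pose H N := \prod_(1 <= m < N.+1) h m.
have PH N : cmod (P N t%:C%C) = H N.
  rewrite partial_product_real cmodR normr_prod.
  by apply: eq_bigr => m _; rewrite normrX.
have h0 m : 0 <= h m by rewrite exprn_ge0.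
have H0 N : 0 <= H N by rewrite prodr_ge0.
have HS N : H N.+1 = H N * h N.+1 by rewrite /H big_nat_recr.
have ht m : (0 < m)%N -> h m <= t ^+ n m.
  move=> m0; rewrite lerXn2r ?nnegrE ?(ltW t0)//.
  have r0 := zero_gt0 adm m0; have r4 := zero_ge4 adm m0.
  have d0 : 0 < t / r m by rewrite divr_gt0.
  have d1 : t / r m <= t by rewrite ler_pdivrMr// ler_peMr ?(ltW t0)//; lra.
  by rewrite ler_norml; apply/andP; split; lra.
have hr m : (j < m)%N -> h m <= expR (- ((n m)%:R * (t / r m))).
  move=> jm; have m0 : (0 < m)%N by exact: leq_ltn_trans jm.
  have r0 := zero_gt0 adm m0.
  have tm : t / r m <= 1.
    rewrite ler_pdivrMr// mul1r (le_trans (ltW tr))//.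
    exact: (zero_le adm).
  rewrite -mulrN expRM_natl lerXn2r ?nnegrE ?expR_ge0// ger0_norm ?subr_ge0//.
  exact: expR_ge1Dx.
have HN N : H N <= t ^+ S N.
  elim: N => [|N IHN]; first by rewrite /H /S !big_geq.
  by rewrite HS /S big_nat_recr//= exprD ler_pM// ht.
have HjN k : H (j + k.+1)%N <= t ^+ S j * expR (- ((n j.+1)%:R * (t / r j.+1))).
  elim: k => [|k IHk]; first by rewrite addn1 HS ler_pM// hr.
  rewrite addnS HS; apply: le_trans IHk; rewrite ler_piMr//.
  apply: le_trans (hr _ _) _; first by rewrite ltnS leq_addr.
  rewrite -expR0 ler_expR oppr_le0 mulr_ge0// divr_ge0 ?(ltW t0)//.
  by rewrite ltW// (zero_gt0 adm).
have c := cmod_partial_product_cvg adm (z := t%:C%C).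
apply: (ler_cvg_to c (cvg_cst _)).
near=> N.
have jN : (j.+1 <= N)%N by near: N; exact: nbhs_infty_ge.
by rewrite /= PH -(subnKC jN) addSnnS; exact: HjN.
Unshelve. all: by end_near. Qed.

(** The list of everything that the choice of the zero near which the estimate
    is violated has to satisfy; the last item makes r_k^(1/L) exceed [M] when
    M >= 0. *)
Lemma good_index_near (L K d M : R) : 1 < L -> 0 < d ->
  \forall k \near \oo, [/\ 8 <= k%:R :> R, 4 * L <= k%:R, k%:R^-1 <= d,
    K <= eps k * ln (r k) `^ k%:R^-1 & M `^ L < r k].
Proof.
move=> L1 d0; have [_ _ _ _ epsoo] := adm.
near=> k; have k1 : (1 < k)%N by near: k; exact: nbhs_infty_gt.
split => //.
- by near: k; exact: nbhs_infty_ger.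
- by near: k; exact: nbhs_infty_ger.
- by rewrite invf_ple ?posrE ?ltr0n ?(ltnW k1)//; near: k; exact: nbhs_infty_ger.
- by near: k; move/cvgryPge : epsoo.
- apply: (@lt_le_trans _ _ (2 ^+ k)); last by apply: (zero_ge_exp2 adm); exact: ltnW.
  apply: (@le_lt_trans _ _ k%:R); first by near: k; exact: nbhs_infty_ger.
  by rewrite -natrX ltr_nat ltn_expl.
Unshelve. all: by end_near. Qed.

(** Write x = log r_(j+1) and e = eps_(j+1).  The middle bound is the logarithm of
    r_j^(j+1) <= n_(j+1).  With the number of zeros at most r_j^2 it gives
    S_j <= exp (2 e x / (j+1)) <= exp (e x / 4); and x <= exp (e x / 4) because
    e x^(1/2) >= 8. *)
Lemma sparse_zero_bounds (j : nat) : (7 <= j)%N ->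
  8 <= eps j.+1 * ln (r j.+1) `^ j.+1%:R^-1 ->
  [/\ 1 <= ln (r j.+1), j.+1%:R * ln (r j) <= eps j.+1 * ln (r j.+1) &
    (S j)%:R * ln (r j.+1) <= expR (eps j.+1 * ln (r j.+1) / 2)].
Proof.
move=> j7; have j0 : (0 < j)%N by exact: leq_trans j7.
set x := ln _; set e := eps _ => ex.
have k0 : (0 < j.+1)%N by [].
have e0 : 0 < e by exact: (eps_gt0 adm).
have e1 : e < 1 by exact: (eps_lt1 adm).
have rj := zero_gt0 adm j0; have rk := zero_gt0 adm k0.
have r4 := zero_ge4 adm k0.
have x1 : 1 <= x.
  apply: (@le_trans _ _ (ln (2 ^+ 2))).
    by rewrite lnXn// mulr2n; have := ln2_ge R; lra.
  by rewrite ler_ln ?posrE// -natrX.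
have kX : j.+1%:R * ln (r j) <= e * x.
  have -> : e * x = ln (n j.+1)%:R by rewrite (multiplicityE adm)// ln_powR.
  rewrite mulr_natl -lnXn// ler_ln ?posrE ?exprn_gt0//.
    exact: (multiplicity_growth adm).
  by rewrite ltr0n (multiplicity_gt0 adm).
split => //.
have xs : x <= expR (e * x / 4).
  have x0 : 0 <= x by lra.
  have -> : x = (x `^ 2^-1) ^+ 2.
    by rewrite -powR_mulrn ?powR_ge0// -powRrM mulVf ?powRr1// pnatr_eq0.
  set s := x `^ 2^-1; have s0 : 0 <= s by exact: powR_ge0.
  have es : 8 <= e * s.
    apply: le_trans ex _; rewrite ler_pM2l// ler_powR//.
    by rewrite lef_pV2 ?posrE ?ltr0n// ler_nat ltnS.
  apply: expR_ge_sqr => //.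
  have : 8 * s <= e * s * s by rewrite ler_wpM2r.
  by rewrite expr2; lra.
have Sx : (S j)%:R <= expR (e * x / 4).
  apply: le_trans (zero_count_le j0) _.
  rewrite -{1}(lnK (x := r j)) ?posrE// -expRM_natl ler_expR.
  have X0 : 0 <= ln (r j) by rewrite ln_ge0//; have := zero_ge4 adm j0; lra.
  have : 8 * ln (r j) <= j.+1%:R * ln (r j) by rewrite ler_wpM2r// ler_nat.
  lra.
have -> : e * x / 2 = e * x / 4 + e * x / 4 by field.
rewrite expRD ler_pM//; lra.
Qed.

Lemma no_min_modulus_bound (delta L C : R) :
  0 < delta -> 1 < L -> 0 < C ->
  ~ \forall rho \near +oo, exists2 t : R, rho < t < rho `^ L &
      (lne (min_modulus f t)%:E / lne (max_modulus f rho)%:E >=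
       (L * (1 - C / ln rho `^ delta))%:E)%E.
Proof.
move=> d0 L1 C0 [M [_ HM]].
have L0 : 0 < L by lra.
(* 8 serves the exponential growth; the other bound gives a < e / 4 below,
   as (log rho)^delta = (x / L)^delta *)
pose K := Num.max 8 (4 * C * L `^ delta + 1).
have [k] := @filter_ex _ \oo _ _ (good_index_near K (Num.max 1 M) L1 d0).
case: k => [|j] [k8 kL kd kK kM].
  by move: k8; rewrite ler_nat.
have j7 : (7 <= j)%N by move: k8; rewrite ler_nat.
have j0 : (0 < j)%N by exact: leq_trans j7.
have K8 : 8 <= eps j.+1 * ln (r j.+1) `^ j.+1%:R^-1.
  by apply: le_trans kK; rewrite /K le_max lexx.
have [x1 kX Sx] := sparse_zero_bounds j7 K8.
set k := j.+1 in k8 kL kd kK kM K8 x1 kX Sx *.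
set x := ln (r k) in kX x1 Sx K8 kK; set e := eps k in K8 kX Sx kK.
have e0 : 0 < e by exact: (eps_gt0 adm).
have e1 : e < 1 by exact: (eps_lt1 adm).
have rk := zero_gt0 adm (isT : (0 < k)%N).
have rj := zero_gt0 adm j0; have rj4 := zero_ge4 adm j0.
have x0 : 0 < x by lra.
(* the interval (rho, rho^L) ends at the zero r_k *)
pose rho := r k `^ L^-1.
have rhoL : rho `^ L = r k.
  by rewrite /rho -powRrM mulVf ?powRr1 ?gt_eqF// ltW.
have Mrho : Num.max 1 M < rho.
  rewrite ltNge; apply/negP => rM.
  have : r k <= Num.max 1 M `^ L.
    rewrite -rhoL ge0_ler_powR ?nnegrE ?powR_ge0 ?(ltW L0)//.
    by rewrite le_max ler01.
  by rewrite leNgt kM.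
move: Mrho; rewrite gt_max => /andP[rho1 Mrho].
have rho0 : 0 < rho by lra.
have lnrho : ln rho = x / L by rewrite /rho ln_powR mulrC.
have [t /andP[rt tr]] := HM rho Mrho.
rewrite rhoL in tr; rewrite lnrho.
have t0 : 0 < t by lra.
apply/negP; rewrite -ltNge.
set a := C / _.
have ae : 0 <= a < e / 4.
  have xd : 0 < x `^ delta by rewrite powR_gt0.
  have Ld : 0 < L `^ delta by rewrite powR_gt0.
  have -> : a = C * L `^ delta / x `^ delta.
    rewrite /a powRM ?invr_ge0 ?ltW// powRVl ?ltW// powRN.
    by field; rewrite !gt_eqF.
  rewrite divr_ge0 ?mulr_ge0 ?(ltW C0) ?(ltW Ld) ?(ltW xd)//= ltr_pdivrMr//.
  have : K <= e * x `^ delta.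
    apply: le_trans kK _; by rewrite ler_pM2l// ler_powR.
  have : 4 * C * L `^ delta + 1 <= K by rewrite /K le_max lexx orbT.
  lra.
have X0 : 0 <= ln (r j) by rewrite ln_ge0//; lra.
have LX : L * ln (r j) <= e / 4 * x.
  have : 4 * L * ln (r j) <= k%:R * ln (r j) by rewrite ler_wpM2r.
  lra.
have N1 : 1 <= (S j)%:R :> R by rewrite ler1n zero_count_gt0.
have yx : ln t < x by rewrite ltr_ln ?posrE.
have e01 : 0 < e < 1 by rewrite e0.
have key := jump_inequality N1 x0 yx e01 ae X0 L0 LX Sx.
have lnF : (S j)%:R * (x / L - ln (r j)) <= ln (F rho).
  have q0 : 0 < rho / r j by rewrite divr_gt0.
  have := majorant_limit_ge_pow j0 rho0.
  have qS : 0 < (rho / r j) ^+ S j by rewrite exprn_gt0.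
  move=> qF; have F0 := lt_le_trans qS qF.
  apply: (@le_trans _ _ (ln ((rho / r j) ^+ S j))); last by rewrite ler_ln ?posrE.
  by rewrite lnXn// -[ln _ *+ _]mulr_natl ln_div ?posrE// lnrho.
have Lj : 0 < x / L - ln (r j).
  have : 0 < L * (x / L - ln (r j)).
    have -> : L * (x / L - ln (r j)) = x - L * ln (r j).
      by field; rewrite gt_eqF.
    have : e * x < x by rewrite gtr_pMl.
    lra.
  by rewrite pmulr_rgt0.
have lnF0 : 0 < ln (F rho).
  by apply: lt_le_trans lnF; rewrite mulr_gt0//; lra.
rewrite (max_modulusE adm (ltW rho0)); apply: lne_ratio_lt => //.
  apply: lt_le_trans (majorant_limit_ge_linear adm (ltW rho0)).
  by rewrite ltr_pwDl// divr_ge0 ?(ltW rho0)// ltW// (zero_gt0 adm).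
move=> m0.
have c0 : 0 < L * (1 - a) by rewrite mulr_gt0//; case/andP: ae => _; lra.
apply: (@lt_le_trans _ _ (L * (1 - a) * ((S j)%:R * (x / L - ln (r j)))));
  last by rewrite ler_pM2l.
apply: le_lt_trans key.
have mle : min_modulus f t <=
    t ^+ S j * expR (- ((n k)%:R * (t / r k))).
  apply: le_trans (min_modulus_le _ _ (ltW t0)) _.
  apply: infinite_product_near_zero; rewrite tr andbT; lra.
apply: (@le_trans _ _ (ln (t ^+ S j * expR (- ((n k)%:R * (t / r k)))))).
  by rewrite ler_ln ?posrE// (lt_le_trans m0).
rewrite lnM ?posrE ?exprn_gt0 ?expR_gt0// expRK lnXn// -[ln t *+ _]mulr_natl lerD2l lerN2.
have -> : (n k)%:R = expR (e * x).
  by rewrite (multiplicityE adm)// -ln_powR lnK// posrE powR_gt0.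
by rewrite !expRD expRN !lnK ?posrE// mulrA lexx.
Qed.

End MinimumModulus.

Theorem mainTheorem9 (R : realType) :
  (exists eps r : nat -> R, admissible eps r) /\
  (forall eps r : nat -> R, admissible eps r ->
    let f := infinite_product eps r in
    [/\ forall z : R[i], cvg (partial_product eps r N z @[N --> \oo]),
        transcendental_entire f,
        growth_order f = 0%E
      & ~ exists delta L C : R,
          [/\ 0 < delta <= 1, 1 < L, 0 < C &
            \forall rho \near +oo, exists2 t : R, rho < t < rho `^ L &
              (lne (min_modulus f t)%:E / lne (max_modulus f rho)%:E >=
               (L * (1 - C / ln rho `^ delta))%:E)%E]]).
Proof.
split; first exact: admissible_exists.
move=> eps r adm f; split.
- exact: partial_product_cvg.
- exact: infinite_product_transcendental.
- exact: infinite_product_order0.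
- move=> [delta [L [C [/andP[d0 _] L1 C0 H]]]].
  exact: (@no_min_modulus_bound _ _ _ adm _ _ _ d0 L1 C0 H).
Qed.
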